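(* Let $\mathcal{S}_1=(\mathcal{X}_1,\mathcal{U}_1,\rightsquigarrow_1)$ and $\mathcal{S}_2=(\mathcal{X}_2,\mathcal{U}_2,\rightsquigarrow_2)$ be transition systems such that $\mathcal{S}_2$ is an alternating simulation of $\mathcal{S}_1$, with alternating simulation relation $R\subseteq\mathcal{X}_1\times\mathcal{X}_2$ and associated extended alternating simulation relation $R^e$. For $x_2\in\mathcal{X}_2$ let $R(x_2)\subseteq\mathcal{X}_1$ be the set of all $x_1\in\mathcal{X}_1$ such that $(x_1,x_2)\in R$. If $v_1:\mathcal{X}_1\to\mathbb{R}$ is a Lyapunov-like function for $\mathcal{S}_1$ with cost function $\mathcal{J}_1(x_1,u_1)$, then $$v_2(x_2)=\min_{x_1\in R(x_2)}v_1(x_1)$$ is a Lyapunov-like function for $\mathcal{S}_2$ with any cost function $\mathcal{J}_2(x_2,u_2)$ that verifies $$\mathcal{J}_1(x_1,u_1)\ge\mathcal{J}_2(x_2,u_2)\qquad\text{for all }(x_1,x_2,u_1,u_2)\in R^e .$$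
   Context: A transition system is a tuple $\mathcal{S}=(\mathcal{X},\mathcal{U},\rightsquigarrow)$ with state set $\mathcal{X}$, input set $\mathcal{U}$ and transition set $\rightsquigarrow\ \subseteq\mathcal{X}\times\mathcal{U}\times\mathcal{X}$; write $x\overset{u}{\rightsquigarrow}x'$ for $(x,u,x')\in\ \rightsquigarrow$. Define $\mathrm{Post}(x,\rightsquigarrow,u)=\{x'\in\mathcal{X}: x\overset{u}{\rightsquigarrow}x'\}$ and $\mathrm{Available}(x,\rightsquigarrow)=\{u\in\mathcal{U}:\exists x'\in\mathcal{X},\ x\overset{u}{\rightsquigarrow}x'\}$. Alternating simulation. Given $\mathcal{S}_1,\mathcal{S}_2$ and a relation $R\subseteq\mathcal{X}_1\times\mathcal{X}_2$, the extended relation $R^e$ is the set of $(x_1,x_2,u_1,u_2)$ such that for every $x_2'\in\mathrm{Post}(x_2,\rightsquigarrow_2,u_2)$ there exists $x_1'\in\mathrm{Post}(x_1,\rightsquigarrow_1,u_1)$ with $(x_1',x_2')\in R$. If for all $(x_1,x_2)\in R$ and all $u_1\in\mathrm{Available}(x_1,\rightsquigarrow_1)$ there exists $u_2\in\mathrm{Available}(x_2,\rightsquigarrow_2)$ with $(x_1,x_2,u_1,u_2)\in R^e$, then $R$ is an alternating simulation relation, $R^e$ is its associated extended alternating simulation relation, and $\mathcal{S}_2$ is an alternating simulation of $\mathcal{S}_1$. Lyapunov-like function. A function $v:\mathcal{X}\to\mathbb{R}$ is a Lyapunov-like function with stage cost (cost function) $\mathcal{J}(x,u)$ for $\mathcal{S}=(\mathcal{X},\mathcal{U},\rightsquigarrow)$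 in a domain $\mathcal{X}_v\subseteq\mathcal{X}$ if $v$ is bounded from below within $\mathcal{X}_v$ and for all $x\in\mathcal{X}_v$ there exists $u\in\mathrm{Available}(x,\rightsquigarrow)$ fulfilling the Bellman inequality $$v(x)\ge\mathcal{J}(x,u)+\max_{x'\in\mathrm{Post}(x,\rightsquigarrow,u)}v(x').$$
   Formalization: The max over Post in the Bellman inequality is read as a supremum, since for infinite Post the max of v_2 need not be attained; v_2 is Lyapunov-like in the domain of those x_2 with R(x_2) nonempty, where the min is defined (more generally, where it is attained in the domain of v_1). *)

(* Defs.v *)
From mathcomp Require Import all_boot all_order all_algebra.
From mathcomp Require Import all_classical all_reals all_analysis.

Set Implicit Arguments.
Unset Strict Implicit.
Unset Printing Implicit Defensive.

Local Open Scope classical_set_scope.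
Local Open Scope ring_scope.

Record transition_system := TransitionSystem {
  state : Type;
  input : Type;
  transition : set (state * input * state) }.

Definition post (S : transition_system) (x : state S) (u : input S) :
    set (state S) :=
  [set x' | transition (x, u, x')].

Definition available (S : transition_system) (x : state S) : set (input S) :=
  [set u | exists x', transition (x, u, x')].

Definition extended_relation (S1 S2 : transition_system)
    (R : set (state S1 * state S2)) :
    set (state S1 * state S2 * input S1 * input S2) :=
  [set w | let: (x1, x2, u1, u2) := w in
    forall x2', post x2 u2 x2' -> exists2 x1', post x1 u1 x1' & R (x1', x2')].

Definition alternating_simulation_relation (S1 S2 : transition_system)
    (R : set (state S1 * state S2)) : Prop :=
  forall x1 x2, R (x1, x2) ->
  forall u1, available x1 u1 ->
  exists2 u2, available x2 u2 & extended_relation R (x1, x2, u1, u2).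

(* The maximum over successors is the extended-real supremum, since [post x u]
   may be infinite. The set is nonempty because [u] is available, so the
   inequality forces the supremum to be finite; when the maximum is attained,
   the two coincide. *)
Definition bellman_inequality (K : realType) (S : transition_system)
    (J : state S -> input S -> K) (v : state S -> K)
    (x : state S) (u : input S) : Prop :=
  ((v x)%:E >= (J x u)%:E + ereal_sup [set (v x')%:E | x' in post x u])%E.

Definition lyapunov_like (K : realType) (S : transition_system)
    (Xv : set (state S)) (J : state S -> input S -> K) (v : state S -> K) :
    Prop :=
  has_lbound [set v x | x in Xv] /\
  forall x, Xv x -> exists2 u, available x u & bellman_inequality J v x u.

Definition is_minimum (K : realType) (A : set K) (m : K) : Prop :=
  A m /\ lbound A m.

(* [ysection R x2] is the set R(x2) of all [x1] related to [x2]. The value of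
   [v2] is left arbitrary where R(x2) is empty. *)
Definition is_min_over_relation (K : realType) (S1 S2 : transition_system)
    (R : set (state S1 * state S2)) (v1 : state S1 -> K) (v2 : state S2 -> K) :
    Prop :=
  forall x2, ysection R x2 !=set0 ->
    is_minimum [set v1 x1 | x1 in ysection R x2] (v2 x2).

(* The states [x2] at which the minimum of [v1] over R(x2) is attained inside
   [X1]; for [X1 = setT], if every nonempty R(x2) has a minimum, these are
   exactly the [x2] with R(x2) nonempty. *)
Definition induced_domain (K : realType) (S1 S2 : transition_system)
    (R : set (state S1 * state S2)) (v1 : state S1 -> K) (X1 : set (state S1)) :
    set (state S2) :=
  [set x2 | exists2 x1, (ysection R x2 `&` X1) x1 &
    is_minimum [set v1 y1 | y1 in ysection R x2] (v1 x1)].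

(* Main.v *)
(** At a minimiser [x1] of [v1] over R(x2), an input [u1] satisfying the Bellman
    inequality is matched by some [u2] with [(x1, x2, u1, u2)] in R^e; every
    successor of [x2] under [u2] is then related to a successor of [x1] under
    [u1], so passing to [x2] can only lower the worst-case successor value. *)

Require Import Defs.
From mathcomp Require Import all_boot all_order all_algebra.
From mathcomp Require Import all_classical all_reals all_analysis.

Local Open Scope classical_set_scope.
Local Open Scope ring_scope.
Import Order.TTheory.

Lemma is_minimum_unique (K : realType) (A : set K) (m m' : K) :
  is_minimum A m -> is_minimum A m' -> m = m'.
Proof.
move=> [Am lbm] [Am' lbm']; apply/eqP.
by rewrite eq_le (lbm _ Am') (lbm' _ Am).
Qed.

Lemma min_over_relation_le (K : realType) (S1 S2 : transition_system)
    (R : set (state S1 * state S2)) (v1 : state S1 -> K) (v2 : state S2 -> K)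
    (x1 : state S1) (x2 : state S2) :
  is_min_over_relation R v1 v2 -> R (x1, x2) -> v2 x2 <= v1 x1.
Proof.
move=> min_v2 /ysectionP Rx; have [_] := min_v2 x2 (ex_intro _ x1 Rx).
by apply; exists x1.
Qed.

(** The related [x1'] that R^e supplies also shows that R(x2') is nonempty, so [v2 x2'] is a genuine
    minimum and never one of the arbitrary values of [v2]. *)
Lemma ereal_sup_post_le (K : realType) (S1 S2 : transition_system)
    (R : set (state S1 * state S2)) (v1 : state S1 -> K) (v2 : state S2 -> K)
    (x1 : state S1) (x2 : state S2) (u1 : input S1) (u2 : input S2) :
  is_min_over_relation R v1 v2 -> extended_relation R (x1, x2, u1, u2) ->
  (ereal_sup [set (v2 x')%:E | x' in post x2 u2] <=
   ereal_sup [set (v1 x')%:E | x' in post x1 u1])%E.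
Proof.
move=> min_v2 Re; apply: ge_ereal_sup => _ [x2' post2 <-].
have [x1' post1 Rx'] := Re _ post2.
apply: (@le_trans _ _ (v1 x1')%:E).
  by rewrite lee_fin; apply: min_over_relation_le Rx'.
by apply: ereal_sup_ubound; exists x1'.
Qed.

Theorem theorem1 (K : realType) (S1 S2 : transition_system)
    (R : set (state S1 * state S2))
    (hR : alternating_simulation_relation R)
    (X1 : set (state S1)) (J1 : state S1 -> input S1 -> K)
    (v1 : state S1 -> K) (hv1 : lyapunov_like X1 J1 v1)
    (v2 : state S2 -> K) (hv2 : is_min_over_relation R v1 v2)
    (J2 : state S2 -> input S2 -> K)
    (hJ : forall x1 x2 u1 u2, extended_relation R (x1, x2, u1, u2) ->
       J1 x1 u1 >= J2 x2 u2) :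
  lyapunov_like (induced_domain R v1 X1) J2 v2.
Proof.
(* Both sides are minima of the same set, nonempty because it contains [v1 x1]. *)
have v2E x1 x2 : ysection R x2 x1 ->
    is_minimum [set v1 y1 | y1 in ysection R x2] (v1 x1) -> v2 x2 = v1 x1.
  by move=> Rx; apply: is_minimum_unique; apply: hv2; exists x1.
have [[l lb_l] bellman1] := hv1; split.
  (* The bound [l] of [v1] on [X1] serves again, since the minimiser lies in [X1]. *)
  exists l => _ [x2 [x1 [Rx X1x] min_x1] <-].
  by rewrite (v2E _ _ Rx min_x1); apply: lb_l; exists x1.
move=> x2 [x1 [Rx X1x] min_x1].
have [u1 av1 bellman_u1] := bellman1 _ X1x.
have [u2 av2 Re] := hR _ _ (iffLR (ysectionP _ _ _) Rx) _ av1.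
exists u2 => //; rewrite /bellman_inequality (v2E _ _ Rx min_x1).
(* Stage cost and worst successor value are compared separately, both through the same R^e
   membership. *)
apply: le_trans bellman_u1; apply: leeD; first by rewrite lee_fin; exact: hJ Re.
exact: ereal_sup_post_le Re.
Qed.
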